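(* Let $q$ be a prime power, $4\le h\le k$ integers, and $$D_1=\Bigl\{(x_1,\ldots,x_k)\in\mathbb{F}_q^k\setminus\{0\}:\Bigl(\sum_{i=1}^h x_i\Bigr)\prod_{i=1}^h x_i=0\Bigr\},\qquad n=\#D_1=q^{k-h-1}\bigl(q^{h+1}-(q-1)^{h+1}+(-1)^h(q-1)\bigr)-1.$$ For $1\le s\le h$ and positive integers $r_1,\ldots,r_l$ with $r_1+\cdots+r_l=s$, set $$Y_{s;r_1,\ldots,r_l}=n-q^{k-1}+(q-1)^{h-s}q^{k-h}\psi_s-q^{k-h}A_{r_1,\ldots,r_l,h-s}+1,\qquad X=n-q^{k-h-1}\bigl(q^h+\psi_h-(q-1)^h\bigr)+1.$$ Then the weight spectrum (set of nonzero weights) of $\mathrm{C}_{D_1}$ is $\{X\}\cup\{Y_{s;r_1,\ldots,r_l}\}$, with $s$ ranging over $1,\ldots,h$ and $(r_1,\ldots,r_l)$ over partitions of $s$. More precisely, the nonzero codewords of $\mathrm{C}_{D_1}$ split as follows: exactly $q^k-q^h$ of them (those coming from linear forms $\sum_i\alpha_ix_i$ with $(\alpha_{h+1},\ldots,\alpha_k)\ne0$) have weight $X$; and for each $s\in\{1,\ldots,h\}$ and each partition $\{r_1,\ldots,r_l\}$ of $s$ into $l$ positive parts, of type $(i_1,\ldots,i_j)$, there are $$\binom{h}{s}\binom{s}{r_1;\ldots;r_l}\binom{l}{i_1;\ldots;i_j}\binom{q-1}{l}$$ further nonzero codewords, each of weight $Y_{s;r_1,\ldots,r_l}$.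
   Context: For a finite ordered (multi)set $D=\{P_1,\ldots,P_n\}\subseteq\mathbb{F}_q^k$, the linear code $\mathrm{C}_D$ is $\{(f(P_1),\ldots,f(P_n)): f:\mathbb{F}_q^k\to\mathbb{F}_q \text{ linear}\}$; weights are Hamming weights. For $m\ge0$, $\psi_m$ is the number of $(x_1,\ldots,x_m)\in\mathbb{F}_q^m$ with $\sum x_i=0$ and all $x_i\ne 0$; $\varphi_m$ is the number with $\sum x_i=1$ and all $x_i\ne0$ ($\psi_0=1,\varphi_0=0$). For positive integers define $A_{r_1}=\psi_{r_1}$, $A_{r_1,\ldots,r_m}=\psi_{r_1+\cdots+r_{m-1}}\varphi_{r_m}+(-1)^{r_m}A_{r_1,\ldots,r_{m-1}}$ ($m\ge2$), and $A_{r_1,\ldots,r_l,0}:=A_{r_1,\ldots,r_l}$. A tuple $r_1,\ldots,r_l$ is of type $(i_1,\ldots,i_j)$ if exactly $j$ distinct values occur among $r_1,\ldots,r_l$, repeated $i_1,\ldots,i_j$ times respectively. $\binom{s}{r_1;\ldots;r_l}$ and $\binom{l}{i_1;\ldots;i_j}$ are multinomial coefficients.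
   Formalization: The claim that the spectrum is {X} ∪ {all Y} is left out because it fails when a class is empty (q=2, h=4, k=5: all weights are 16, yet Y_{2;1,1}=18); only the precise split of nonzero codewords is stated, which gives the spectrum over nonempty classes. *)

(* Defs.v *)
From mathcomp Require Import all_boot all_order all_algebra all_field.
Set Implicit Arguments. Unset Strict Implicit. Unset Printing Implicit Defensive.
Import Order.TTheory GRing.Theory Num.Theory.
Local Open Scope ring_scope.

Section Defs.
Variable F : finFieldType.

Definition psi (m : nat) : nat :=
  #|[set x : 'rV[F]_m | (\sum_(i < m) x ord0 i == 0) && [forall i, x ord0 i != 0]]|.
Definition phi (m : nat) : nat :=
  #|[set x : 'rV[F]_m | (\sum_(i < m) x ord0 i == 1) && [forall i, x ord0 i != 0]]|.

(* Arev [:: r_m; ...; r_1] = A_{r_1,...,r_m} *)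
Fixpoint Arev (s : seq nat) : int :=
  match s with
  | [::] => 0
  | [:: r] => (psi r)%:Z
  | rm :: rest => (psi (sumn rest))%:Z * (phi rm)%:Z + (-1) ^+ rm * Arev rest
  end.

Definition A (r : seq nat) : int := Arev (rev r).
Definition Aext (r : seq nat) (t : nat) : int :=
  if t == 0%N then A r else A (rcons r t).

Definition linform k (alpha x : 'rV[F]_k) : F := \sum_(i < k) alpha ord0 i * x ord0 i.

(* the codeword (f(P))_{P in D}, encoded as a function on F^k vanishing off D *)
Definition codeword k (D : {set 'rV[F]_k}) (alpha : 'rV[F]_k) : {ffun 'rV[F]_k -> F} :=
  [ffun P => if P \in D then linform alpha P else 0].

Definition code k (D : {set 'rV[F]_k}) : {set {ffun 'rV[F]_k -> F}} :=
  [set codeword D alpha | alpha in [set: 'rV[F]_k]].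

Definition wt k (c : {ffun 'rV[F]_k -> F}) : nat := #|[set P | c P != 0]|.

Definition D1 k h : {set 'rV[F]_k} :=
  [set x : 'rV[F]_k | (x != 0) &&
     ((\sum_(i < k | (i < h)%N) x ord0 i) * (\prod_(i < k | (i < h)%N) x ord0 i) == 0)].

Definition tail0 k h (alpha : 'rV[F]_k) : bool :=
  [forall i : 'I_k, (h <= i)%N ==> (alpha ord0 i == 0)].

(* the partition of s = #{i <= h | alpha_i <> 0} given by the multiplicities of
   the distinct nonzero values among alpha_1,...,alpha_h (nonincreasing order) *)
Definition pattern k h (alpha : 'rV[F]_k) : seq nat :=
  sort geq [seq m <- [seq #|[set i : 'I_k | (i < h)%N && (alpha ord0 i == c)]|
                      | c <- enum [set c : F | c != 0]] | m != 0%N].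
End Defs.

Definition is_partition (h : nat) (r : seq nat) : bool :=
  [&& sorted geq r, all (fun x => 0 < x)%N r & (1 <= sumn r <= h)%N].

Definition multinom (n : nat) (ks : seq nat) : nat :=
  (n`! %/ \prod_(x <- ks) x`!)%N.

Definition ptype (r : seq nat) : seq nat := [seq count_mem v r | v <- undup r].

Definition Ncount (q h : nat) (r : seq nat) : nat :=
  ('C(h, sumn r) * multinom (sumn r) r * multinom (size r) (ptype r)
     * 'C(q.-1, size r))%N.

(* Main.v *)
Require Import Defs.
From mathcomp Require Import all_boot all_order all_algebra all_field.
From mathcomp Require Import ring zify.
Set Implicit Arguments. Unset Strict Implicit. Unset Printing Implicit Defensive.
Import Order.TTheory GRing.Theory Num.Theory.
Local Open Scope ring_scope.

(** A linear form a kills a point P of D_1 unless P is nonzero, lies outside the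
set U of points whose first h coordinates are nonzero with nonzero sum, and a(P)
is nonzero; hence the weight of a equals n + 1 - q^(k-1) plus the number of
zeros of a on U.  If a involves a coordinate beyond h, translating along that
coordinate shows that a takes every value equally often on U.  Otherwise the
zeros are counted by N(a), the number of y in (F_q^* )^h with sum y = 0 and
a(y) = 0.  Subtracting a constant c from all coefficients does not change N(a);
choosing for c one of the coefficients, of multiplicity r, frees the
corresponding block of variables from the second equation, and this gives
N = psi_R phi_r + (-1)^r N', which is the recursion defining A.

The number of forms with a given multiplicity pattern is obtained by counting
rearrangements of a sequence twice: once for the rows with prescribed
multiplicity of each value, once for the ways to distribute the multiplicities
over the q - 1 nonzero values. *)

(** * Rearrangements of a sequence *)

(** Induction on the length, sorting the rearrangements by first letter. The list [u] may contain
    letters absent from [s], each contributing 0! = 1, so one [u] serves throughout the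
    induction. *)
Lemma size_permutations_mult (T : eqType) (u s : seq T) :
  uniq u -> {subset s <= u} ->
  (size (permutations s) * \prod_(x <- u) (count_mem x s)`! = (size s)`!)%N.
Proof.
move=> uu; have [n] := ubnP (size s); elim: n s => // n IHn s lt_sn su.
case: (posnP (size s)) => [/size0nil ->|s_gt0].
  by rewrite big1_seq //.
have rem_su x : {subset rem x s <= u} by move=> y /mem_rem /su.
rewrite (perm_size (permutationsE s_gt0)) size_allpairs_dep sumnE !big_map.
rewrite big_distrl /=.
transitivity (\sum_(x <- undup s) count_mem x s * (size s).-1`!)%N.
  apply: eq_big_seq => x; rewrite mem_undup => xs.
  have xu := su x xs.
  rewrite -(size_rem xs) -(IHn (rem x s)) ?size_rem //; last first.
    by case: (s) s_gt0 lt_sn => //= ? ? _; rewrite ltnS => /leq_trans->.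
  rewrite mulnCA; congr (_ * _)%N.
  rewrite !(big_rem x xu) /= mulnA; congr (_ * _)%N.
    have : (0 < count_mem x s)%N by rewrite -has_count has_pred1.
    rewrite count_mem_rem eqxx; case: (count_mem x s) => // c _.
    by rewrite factS subn1.
  apply: eq_big_seq => y; rewrite mem_rem_uniq // inE => /andP[/= nyx _].
  by rewrite count_mem_rem eq_sym (negPf nyx) subn0.
rewrite -big_distrl /=.
have -> : (\sum_(x <- undup s) count_mem x s)%N = size s.
  rewrite -sum1_size -[RHS]big_undup_iterop_count /=.
  apply: eq_bigr => x _.
  by elim: (count_mem x s) => // -[|c] //= ->.
by case: (size s) s_gt0 => // m _; rewrite factS.
Qed.

(** * Counting vectors with nonzero entries under one or two linear conditions *)

Section Counting.
Variable F : finFieldType.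

Definition cons_row n (t : F) (y : 'rV[F]_n) : 'rV[F]_n.+1 :=
  \row_i oapp (y ord0) t (unlift ord0 i).

Lemma cons_row0 n (t : F) (y : 'rV[F]_n) : cons_row t y ord0 ord0 = t.
Proof. by rewrite mxE unlift_none. Qed.

Lemma cons_rowS n (t : F) (y : 'rV[F]_n) i : cons_row t y ord0 (lift ord0 i) = y ord0 i.
Proof. by rewrite mxE liftK. Qed.

Lemma big_cons_row n (f : 'rV[F]_n.+1 -> nat) :
  (\sum_x f x = \sum_t \sum_y f (cons_row t y))%N.
Proof.
rewrite pair_big /= (reindex (fun p : F * 'rV[F]_n => cons_row p.1 p.2)) //=.
exists (fun x => (x ord0 ord0, \row_i x ord0 (lift ord0 i))).
  move=> [t y] _ /=; rewrite cons_row0; congr (_, _).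
  by apply/rowP => i; rewrite mxE cons_rowS.
move=> x _; apply/rowP => i; rewrite mxE.
by case: unliftP => [j|] -> /=; rewrite ?mxE.
Qed.

Lemma big_row_mx m n (f : 'rV[F]_(m + n) -> nat) :
  (\sum_x f x = \sum_y \sum_z f (row_mx y z))%N.
Proof.
rewrite pair_big /= (reindex (fun p : 'rV[F]_m * 'rV[F]_n => row_mx p.1 p.2)) //=.
exists (fun x => (lsubmx x, rsubmx x)).
  by move=> [y z] _; rewrite row_mxKl row_mxKr.
by move=> x _; rewrite hsubmxK.
Qed.

Lemma card_set_sum (T : finType) (P : pred T) : #|[set x | P x]| = (\sum_x P x)%N.
Proof. by rewrite -sum1dep_card big_mkcond; apply: eq_bigr => x _; case: (P x). Qed.

(* cnt1 m a: number of x in (F^* )^m with sum a *)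
Fixpoint cnt1 (m : nat) (a : F) : nat :=
  if m is m'.+1 then (\sum_(t : F | t != 0%R) cnt1 m' (a - t)%R)%N else a == 0.

(* cnt2 s a b: number of x in (F^* )^(size s) with sum a and s-weighted sum b *)
Fixpoint cnt2 (s : seq F) (a b : F) : nat :=
  if s is c :: s' then (\sum_(t : F | t != 0%R) cnt2 s' (a - t)%R (b - c * t)%R)%N
  else (a == 0) && (b == 0).

Arguments cnt1 m%_N a%_R.
Arguments cnt2 s%_SEQ (a b)%_R.

(** A sequence of coefficients, unlike a row, is easily permuted and cut into blocks of equal
    value. *)
Lemma card_cnt2 n (c : 'rV[F]_n) a b :
  #|[set x : 'rV[F]_n | [&& [forall i, x ord0 i != 0], \sum_i x ord0 i == a
                          & linform c x == b]]|
  = cnt2 [seq c ord0 i | i <- enum 'I_n] a b.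
Proof.
rewrite card_set_sum; elim: n c a b => [|n IHn] c a b.
  rewrite [enum 'I_0]size0nil ?size_enum_ord //=.
  rewrite (big_pred1 0) => [|x]; last by rewrite !thinmx0 /= eqxx.
  rewrite /linform !big_ord0 !(eq_sym 0).
  by case: forallP => // -[] [].
rewrite big_cons_row enum_ordSl /= -map_comp [RHS]big_mkcond /=.
apply: eq_bigr => t _.
have [->|t0] /= := eqVneq t 0.
  rewrite big1 // => y _; case: forallP => //= /(_ ord0).
  by rewrite cons_row0 eqxx.
pose c' : 'rV[F]_n := \row_i c ord0 (lift ord0 i).
have -> : [seq (c ord0 \o lift ord0) i | i <- enum 'I_n]
        = [seq c' ord0 i | i <- enum 'I_n] by apply: eq_map => i; rewrite mxE.
rewrite -IHn; apply: eq_bigr => y _; congr (nat_of_bool _).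
rewrite /linform !big_ord_recl !cons_row0.
congr [&& _, _ & _].
- apply/forallP/forallP => H i; first by have := H (lift ord0 i); rewrite cons_rowS.
  by case: (unliftP ord0 i) => [j|] ->; rewrite ?cons_rowS ?cons_row0.
- under eq_bigr do rewrite cons_rowS.
  by rewrite addrC [RHS]eq_sym subr_eq eq_sym.
under eq_bigr do rewrite cons_rowS.
under [in RHS]eq_bigr do rewrite mxE.
by rewrite addrC [RHS]eq_sym subr_eq eq_sym.
Qed.

(** The sums over two consecutive variables commute, so [x] can be moved to the front. *)
Lemma cnt2_rem x s : x \in s -> cnt2 s =2 cnt2 (x :: rem x s).
Proof.
elim: s => // y s IHs; rewrite inE /= => xys a b.
have [->//|nxy] := eqVneq y x.
move: xys; rewrite eq_sym (negPf nxy) /= => xs.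
under eq_bigr do rewrite IHs //=.
rewrite exchange_big /=; apply: eq_bigr => t _; apply: eq_bigr => u _.
by congr (cnt2 _ _ _); ring.
Qed.

Lemma cnt2_perm s1 s2 : perm_eq s1 s2 -> cnt2 s1 =2 cnt2 s2.
Proof.
elim: s1 s2 => [|x s1 IHs] s2 p12.
  by have /size0nil-> : size s2 = 0%N by rewrite -(perm_size p12).
have xs2 : x \in s2 by rewrite -(perm_mem p12) mem_head.
move=> a b; rewrite (cnt2_rem xs2) /=; apply: eq_bigr => t _.
by apply: IHs; rewrite -(perm_cons x) (perm_trans p12) ?perm_to_rem.
Qed.

(** On vectors of sum [a], adding [c] to every coefficient shifts the weighted sum by [c * a]; for
    [a = 0] nothing changes. *)
Lemma cnt2_shear c s a b : cnt2 [seq x + c | x <- s] a b = cnt2 s a (b - c * a).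
Proof.
elim: s a b => /= [a b|x s IHs a b].
  by have [->|//] := eqVneq a 0; rewrite mulr0 subr0.
by apply: eq_bigr => t _; rewrite IHs; congr (cnt2 _ _ _); ring.
Qed.

(** Once the plain sum is unconstrained, a variable with coefficient 0 is free, and any other
    variable can be rescaled to absorb its coefficient. *)
Lemma sum_cnt2 s b :
  (\sum_a cnt2 s a b = #|F|.-1 ^ count_mem 0%R s * cnt1 (size s - count_mem 0%R s) b)%N.
Proof.
elim: s b => /= [b|c s IHs b].
  rewrite mul1n (bigD1 0) //= eqxx big1 ?addn0 //.
  by move=> a /negPf ->.
rewrite exchange_big /=.
transitivity (\sum_(t | t != 0%R) \sum_a cnt2 s a (b - c * t))%N.
  apply: eq_bigr => t _; rewrite [RHS](reindex_inj (addIr (- t))) //=.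
under eq_bigr do rewrite IHs.
have [->|c0] := eqVneq c 0.
  under eq_bigr do rewrite mul0r subr0.
  rewrite sum_nat_const cardC1 /= add1n subSS expnS mulnA; congr (_ * _)%N.
rewrite -big_distrr /= add0n subSn ?count_size //; congr (_ * _)%N.
rewrite [RHS](reindex_inj (mulfI c0)) /=.
by apply: eq_bigl => t; rewrite mulf_eq0 (negPf c0).
Qed.

Lemma cnt2_cat_nseq0 r s a b :
  cnt2 (nseq r 0 ++ s) a b = (\sum_c cnt1 r c * cnt2 s (a - c) b)%N.
Proof.
elim: r a => /= [|r IHr] a.
  rewrite (bigD1 0) //= eqxx subr0 mul1n big1 ?addn0 // => c /negPf -> //.
under [RHS]eq_bigr do rewrite big_distrl /=.
rewrite exchange_big /=; apply: eq_bigr => t _.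
rewrite mul0r subr0 IHr [RHS](reindex_inj (addIr t)) /=.
by apply: eq_bigr => c _; rewrite addrK opprD addrA addrAC.
Qed.

Lemma cnt1_scale m c a : c != 0 -> cnt1 m (c * a) = cnt1 m a.
Proof.
move=> c0; elim: m a => /= [|m IHm] a; first by rewrite mulf_eq0 (negPf c0).
rewrite (reindex_inj (mulfI c0)) /=.
apply: eq_big => t; first by rewrite mulf_eq0 (negPf c0).
by rewrite -mulrBr IHm.
Qed.

Lemma cnt1_nz m a : a != 0 -> cnt1 m a = cnt1 m 1.
Proof. by move=> a0; rewrite -[in LHS](mulr1 a) cnt1_scale. Qed.

Lemma card_cnt1 m a :
  #|[set x : 'rV[F]_m | (\sum_(i < m) x ord0 i == a) && [forall i, x ord0 i != 0]]|
  = cnt1 m a.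
Proof.
transitivity (cnt2 [seq (0 : 'rV[F]_m) ord0 i | i <- enum 'I_m] a 0).
  rewrite -card_cnt2; apply: eq_card => x; rewrite !inE andbC.
  rewrite /linform [X in [&& _, _ & X == 0]]big1 ?eqxx ?andbT // => i _.
  by rewrite mxE mul0r.
have -> : [seq (0 : 'rV[F]_m) ord0 i | i <- enum 'I_m] = nseq m 0.
  rewrite -[in RHS](size_enum_ord m).
  by elim: (enum 'I_m) => //= i e ->; rewrite mxE.
rewrite -[nseq m 0]cats0 cnt2_cat_nseq0 (bigD1 a) //= subrr eqxx muln1.
by rewrite big1 ?addn0 // => c; rewrite eq_sym -subr_eq0 => /negPf ->; rewrite muln0.
Qed.

Lemma psiE m : psi F m = cnt1 m 0. Proof. exact: card_cnt1. Qed.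
Lemma phiE m : phi F m = cnt1 m 1. Proof. exact: card_cnt1. Qed.

Lemma sum_cnt1_neq0 m : (\sum_(a | a != 0%R) cnt1 m a = #|F|.-1 * phi F m)%N.
Proof.
under eq_bigr => a a0 do rewrite cnt1_nz //.
by rewrite sum_nat_const cardC1 phiE.
Qed.

Lemma psi0 : psi F 0 = 1%N. Proof. by rewrite psiE /= eqxx. Qed.

(** One variable is minus the sum of the other [m], so that sum must be nonzero; each nonzero value
    is taken [phi F m] times. *)
Lemma psiS m : psi F m.+1 = (#|F|.-1 * phi F m)%N.
Proof.
rewrite -sum_cnt1_neq0 psiE /= [RHS](reindex_inj oppr_inj) /=.
by apply: eq_big => t; rewrite ?oppr_eq0 // sub0r.
Qed.

(** A vector of [m] nonzero entries either has sum 0 or extends uniquely to a sum-zero vector with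
    one more nonzero entry. *)
Lemma psi_addS m : (psi F m + psi F m.+1 = #|F|.-1 ^ m)%N.
Proof.
rewrite psiS -sum_cnt1_neq0 psiE.
have -> : (cnt1 m 0 + \sum_(a | a != 0%R) cnt1 m a = \sum_a cnt1 m a)%N.
  by rewrite [RHS](bigD1 0).
elim: m => [|m IHm] /=.
  by rewrite (bigD1 0) //= eqxx big1 // => a /negPf ->.
rewrite exchange_big /=.
transitivity (\sum_(t : F | t != 0%R) \sum_a cnt1 m a)%N.
  by apply: eq_bigr => t _; rewrite [RHS](reindex_inj (addIr (- t))).
by rewrite sum_nat_const cardC1 IHm expnS.
Qed.

Lemma card_pred_gt0 : (0 < #|F|.-1)%N.
Proof. by have := finNzRing_gt1 F; case: #|F| => // -[]. Qed.

(** Using [psi_addS] one step up and cancelling q - 1 gives phi_m + phi_(m+1) = (q-1)^m, the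
    relation that psi also satisfies; hence the difference changes sign at each step. *)
Lemma psi_phi m : (psi F m)%:Z - (phi F m)%:Z = (-1) ^+ m.
Proof.
elim: m => [|m IHm].
  by rewrite psiE phiE /= eqxx oner_eq0.
have Q := card_pred_gt0.
have E1 : ((#|F|.-1 * (phi F m + phi F m.+1 ) = #|F|.-1 * (#|F|.-1 ^ m)))%N.
  by rewrite mulnDr -!psiS psi_addS expnS.
move/eqP: E1; rewrite eqn_pmul2l // => /eqP E1.
rewrite exprS mulN1r -IHm -psi_addS in E1 *.
lia.
Qed.

(** Split by the sum of the zero block: sum 0 contributes psi_r N', the other sums together phi_r (T
    - N'), where N' is the count for [s] and T is its total over all sums. As [s] has no zero
    coefficient, T is psi of its size. *)
Lemma cnt2_nseq0_cat r s : 0 \notin s ->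
  (cnt2 (nseq r 0 ++ s) 0 0)%:Z =
  (psi F (size s))%:Z * (phi F r)%:Z + (-1) ^+ r * (cnt2 s 0 0)%:Z.
Proof.
move=> s0; have := sum_cnt2 s 0.
rewrite (count_memPn s0) expn0 mul1n subn0 -psiE => psi_s.
rewrite cnt2_cat_nseq0 (bigD1 0) //= subr0 -psiE.
under eq_bigr => c c0 do rewrite cnt1_nz // -phiE.
rewrite -big_distrr /= -psi_phi -psi_s [X in _ = X%:Z * _ + _](bigD1 0) //=.
have -> : (\sum_(c | c != 0%R) cnt2 s (0 - c)%R 0 = \sum_(c | c != 0%R) cnt2 s c 0)%N.
  rewrite [RHS](reindex_inj oppr_inj) /=.
  by apply: eq_big => c; rewrite ?oppr_eq0 // sub0r.
by rewrite !PoszD !PoszM; ring.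
Qed.

Lemma cnt2_nseq_cat c r s : c \notin s ->
  (cnt2 (nseq r c ++ s) 0 0)%:Z =
  (psi F (size s))%:Z * (phi F r)%:Z + (-1) ^+ r * (cnt2 s 0 0)%:Z.
Proof.
move=> cs; have shear t : cnt2 t 0 0 = cnt2 [seq x - c | x <- t] 0 0.
  by rewrite cnt2_shear mulr0 subr0.
rewrite shear (shear s) map_cat map_nseq subrr cnt2_nseq0_cat ?size_map //.
by apply: contra cs => /mapP[x xs /esym/eqP]; rewrite subr_eq0 => /eqP <-.
Qed.

(** The head of [C] is the block split off, hence the last part in the recursion for A. The list is
    nonempty because [Arev] is 0 on the empty list while the empty count is 1. *)
Lemma cnt2_flatten (mu : F -> nat) (C : seq F) : C != [::] -> uniq C ->
  (cnt2 (flatten [seq nseq (mu c) c | c <- C]) 0 0)%:Z = Arev F [seq mu c | c <- C].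
Proof.
case: C => // c C _; elim: C c => [|d C IHC] c.
  (* For a single block the remainder counts 1, and [psi_phi] turns phi_r + (-1)^r into psi_r. *)
  move=> _; rewrite [flatten _]/= cnt2_nseq_cat // [cnt2 [::] _ _]/= eqxx psi0 -psi_phi.
  by rewrite [RHS]/= mulr1 mul1r addrC subrK.
have -> : Arev F (map mu (c :: d :: C)) = (psi F (sumn (map mu (d :: C))))%:Z
  * (phi F (mu c))%:Z + (-1) ^+ mu c * Arev F (map mu (d :: C)) by [].
move: (d :: C) (IHC d) => C' {}IHC /= /andP[cC uC].
rewrite cnt2_nseq_cat; last first.
  apply: contra cC => /flattenP[t /mapP[e eC ->]].
  by rewrite mem_nseq => /andP[_ /eqP->].
rewrite -IHC // size_flatten /shape -map_comp.
have -> // : [seq (size \o (fun c0 => nseq (mu c0) c0)) i | i <- C'] = [seq mu i | i <- C'].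
by apply: eq_map => e /=; rewrite size_nseq.
Qed.

End Counting.

(** * Multinomial coefficients and multiplicity patterns *)

Lemma size_sum_count (T : finType) (s : seq T) :
  size s = (\sum_x count_mem x s)%N.
Proof.
elim: s => [|y s IHs] /=; first by rewrite big1.
rewrite big_split /= -IHs (bigD1 y) //= eqxx big1 ?add1n //.
by move=> x nxy; rewrite eq_sym (negPf nxy).
Qed.

Lemma dvdn_prod_fact (r : seq nat) : (\prod_(x <- r) x`! %| (sumn r)`!)%N.
Proof.
elim: r => [|x r IHr]; rewrite ?big_nil // big_cons /=.
rewrite -(bin_fact (leq_addr (sumn r) x)) addKn.
by rewrite dvdn_mull // dvdn_mul.
Qed.

Lemma multinom_mul (r : seq nat) :
  (multinom (sumn r) r * \prod_(x <- r) x`! = (sumn r)`!)%N.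
Proof. by rewrite divnK ?dvdn_prod_fact. Qed.

(** The division is exact because the quotient counts the rearrangements of [r]. *)
Lemma multinom_ptype_mul (r : seq nat) :
  (multinom (size r) (ptype r) * \prod_(v <- undup r) (count_mem v r)`!
   = (size r)`!)%N.
Proof.
rewrite /multinom /ptype big_map divnK //.
have sub : {subset r <= undup r} by move=> x; rewrite mem_undup.
by rewrite -(size_permutations_mult (undup_uniq r) sub) dvdn_mull.
Qed.

(** Turns the pattern condition into a rearrangement condition: the zeros lost by filtering are
    restored by padding, their number being fixed by the length of [t]. *)
Lemma sort_filter_eq (t r : seq nat) :
  sorted geq r -> all (fun x => 0 < x)%N r -> (size r <= size t)%N ->
  (sort geq [seq m <- t | m != 0%N] == r)
  = perm_eq t (r ++ nseq (size t - size r) 0%N).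
Proof.
move=> r_sort r_gt0 le_rt; have fr : [seq m <- r | m != 0%N] = r.
  by apply/all_filterP; apply: sub_all r_gt0 => x; rewrite lt0n.
have geqT : total geq by move=> x y; rewrite /geq /=; lia.
have geqA : antisymmetric geq by move=> x y; rewrite /geq /=; lia.
have geqTr : transitive geq by move=> x y z; rewrite /geq /=; lia.
apply/eqP/idP => [def_r|pt].
  have pf : perm_eq [seq m <- t | m != 0%N] r by rewrite -def_r perm_sym perm_sort.
  rewrite -(perm_filterC (fun m => m != 0%N)); apply: perm_cat => //.
  rewrite -(perm_size pf) size_filter -[X in (X - _)%N](count_predC (fun m => m != 0%N)).
  rewrite addKn -size_filter.
  set z := filter _ t; suff /all_pred1P {1}-> : all (pred1 0%N) z by [].
  by apply/allP => x; rewrite mem_filter /= negbK => /andP[].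
rewrite -[RHS](sorted_sort geqTr r_sort); apply/perm_sortP => //.
move/(perm_filter (fun m => m != 0%N)): pt; rewrite filter_cat fr.
suff -> : [seq m <- nseq (size t - size r) 0%N | m != 0%N] = [::] by rewrite cats0.
by elim: (_ - _)%N.
Qed.

(** * Counting rows with a given pattern *)

Section Rows.
Variable F : finFieldType.

Definition rowseq h (y : 'rV[F]_h) := [seq y ord0 i | i <- enum 'I_h].

Lemma size_rowseq h (y : 'rV[F]_h) : size (rowseq y) = h.
Proof. by rewrite size_map size_enum_ord. Qed.

Lemma card_rowseq_perm h (s : seq F) : size s = h ->
  #|[set y : 'rV[F]_h | perm_eq (rowseq y) s]| = size (permutations s).
Proof.
move=> sz_s; rewrite cardE -(size_map (@rowseq h)); apply: perm_size.
apply: uniq_perm; rewrite ?permutations_uniq //.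
  rewrite map_inj_uniq ?enum_uniq // => y z /eq_in_map eq_yz.
  by apply/rowP => i; apply: eq_yz; rewrite mem_enum.
move=> t; rewrite mem_permutations; apply/mapP/idP => [[y]|pt].
  by rewrite mem_enum inE => py ->.
have rt : rowseq (\row_(i < h) nth 0 t i) = t.
  rewrite -[RHS](mkseq_nth 0) (perm_size pt) sz_s /mkseq -val_enum_ord -map_comp.
  by apply: eq_map => i; rewrite mxE.
by exists (\row_(i < h) nth 0 t i); rewrite ?mem_enum ?inE rt.
Qed.

(** These rows are the rearrangements of one model sequence in which each [c] is repeated [mu c]
    times. *)
Lemma card_rows_count h (mu : F -> nat) : (\sum_c mu c = h)%N ->
  (#|[set y : 'rV[F]_h | [forall c, count_mem c (rowseq y) == mu c]]|
   * \prod_c (mu c)`! = h`!)%N.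
Proof.
move=> sum_mu; pose s := flatten [seq nseq (mu c) c | c <- index_enum F].
have count_s c : count_mem c s = mu c.
  rewrite count_flatten -map_comp sumnE big_map (bigD1 c) //= count_nseq /= eqxx.
  by rewrite mul1n big1 ?addn0 // => d /negPf ndc; rewrite count_nseq /= ndc.
have size_s : size s = h by rewrite size_sum_count -sum_mu; apply: eq_bigr.
rewrite -[in RHS]size_s -(size_permutations_mult (u := index_enum F) (s := s)).
- rewrite -(card_rowseq_perm size_s); congr (_ * _)%N.
    apply: eq_card => y; rewrite !inE; apply/forallP/allP => /= eq_count c.
      by rewrite count_s (eqP (eq_count c)).
    have [cys|] := boolP (c \in rowseq y ++ s).
      by have := eq_count c cys; rewrite count_s.
    rewrite mem_cat negb_or => /andP[/count_memPn-> /count_memPn].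
    by rewrite count_s => ->.
  by apply: eq_bigr => c _; rewrite count_s.
- exact: index_enum_uniq.
by move=> c; rewrite mem_index_enum.
Qed.

(** Zero multiplicities are kept, so that the length is always q - 1 and a position determines a
    value. *)
Definition mults (s : seq F) : seq nat :=
  [seq count_mem c s | c <- enum [set c : F | c != 0]].

Lemma size_mults s : size (mults s) = #|F|.-1.
Proof. by rewrite size_map -cardE cardsE cardC1. Qed.

Lemma big_enum_neq0 (f : F -> nat) :
  (\sum_(c <- enum [set c : F | c != 0%R]) f c = \sum_(c | c != 0%R) f c)%N.
Proof. by rewrite big_enum /=; apply: eq_bigl => c; rewrite inE. Qed.

Lemma count_mem0 s : (count_mem 0%R s + sumn (mults s) = size s)%N.
Proof.
by rewrite sumnE big_map big_enum_neq0 [RHS]size_sum_count [RHS](bigD1 0).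
Qed.

Lemma card_rows_mults h (t : seq nat) : size t = #|F|.-1 -> (sumn t <= h)%N ->
  (#|[set y : 'rV[F]_h | mults (rowseq y) == t]|
   * (\prod_(x <- t) x`! * (h - sumn t)`!) = h`!)%N.
Proof.
move=> sz_t le_th; pose E := enum [set c : F | c != 0].
have szE : size E = #|F|.-1 by rewrite -cardE cardsE cardC1.
have memE c : (c \in E) = (c != 0) by rewrite mem_enum inE.
(* The multiplicity of 0 is not listed in [t]; it is what remains of the length [h]. *)
pose mu c := if c == 0 then (h - sumn t)%N else nth 0%N t (index c E).
have mu0 : mu 0 = (h - sumn t)%N by rewrite /mu eqxx.
have def_t : t = [seq mu c | c <- E].
  apply: (@eq_from_nth _ 0%N) => [|i lt_it]; first by rewrite size_map szE.
  have lt_iE : (i < size E)%N by rewrite szE -sz_t.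
  rewrite (nth_map 0) // /mu index_uniq ?enum_uniq //.
  by have := mem_nth 0 lt_iE; rewrite memE => /negPf->.
have sum_mu : (\sum_c mu c = h)%N.
  rewrite (bigD1 0) //= -big_enum_neq0 -(big_map mu xpredT id) -/E -def_t -sumnE.
  by rewrite mu0 subnK.
rewrite -[RHS](card_rows_count sum_mu); congr (_ * _)%N; last first.
  rewrite [RHS](bigD1 0) //= mulnC mu0; congr (_ * _)%N.
  by rewrite {1}def_t big_map big_enum /=; apply: eq_bigl => c; rewrite inE.
apply: eq_card => y; rewrite !inE; apply/eqP/forallP => [ey c|ey].
  have [->|c0] := eqVneq c 0.
    rewrite -(eqn_add2r (sumn t)) -{1}ey count_mem0 size_rowseq.
    by rewrite mu0 subnK.
  move: ey; rewrite def_t => /eq_in_map/(_ c) -> //; by rewrite memE.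
by rewrite def_t; apply: eq_map => c; apply/eqP.
Qed.

Lemma card_rows_pattern h r : is_partition h r ->
  #|[set y : 'rV[F]_h | sort geq [seq m <- mults (rowseq y) | m != 0%N] == r]|
  = Ncount #|F| h r.
Proof.
case/and3P=> r_sort r_gt0 /andP[_ le_rh].
(* A pattern with more parts than there are nonzero values never occurs, and the last binomial
   coefficient vanishes too. *)
have [lt_Fr|le_rF] := ltnP #|F|.-1 (size r).
  rewrite /Ncount [X in (_ * X)%N]bin_small // muln0; apply/eqP.
  rewrite cards_eq0 -subset0; apply/subsetP => y; rewrite inE => /eqP er.
  move: lt_Fr; rewrite -er size_sort size_filter -(size_mults (rowseq y)).
  by rewrite ltnNge count_size.
pose t0 := r ++ nseq (#|F|.-1 - size r) 0%N.
have sz_t0 : size t0 = #|F|.-1 by rewrite size_cat size_nseq subnKC.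
have sum_t0 : sumn t0 = sumn r by rewrite sumn_cat sumn_nseq mul0n addn0.
pose c1 := (\prod_(x <- r) x`!)%N.
have prod_t0 : (\prod_(x <- t0) x`! = c1)%N.
  rewrite big_cat /= [X in (_ * X)%N]big1_seq ?muln1 // => x.
  by rewrite mem_nseq => /andP[_ /andP[_ /eqP->]].
have card_t0 : (#|[set y : 'rV[F]_h | sort geq [seq m <- mults (rowseq y) | m != 0%N] == r]|
    * (c1 * (h - sumn r)`!) = size (permutations t0) * h`!)%N.
  rewrite card_set_sum.
  (* The indicator of being a rearrangement of [t0] becomes a sum over rearrangements, so that the
     two sums can be exchanged. *)
  under eq_bigr => y _.
    rewrite sort_filter_eq ?size_mults // -mem_permutations.
    rewrite -(count_uniq_mem _ (permutations_uniq _)) -sum1_count big_mkcond.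
    over.
  rewrite exchange_big /= big_distrl /= -(sum1_size (permutations t0)) big_distrl /=.
  apply: eq_big_seq => t; rewrite mem_permutations => pt.
  rewrite mul1n -(@card_rows_mults h t); last 2 first.
  - by rewrite (perm_size pt).
  - by rewrite (perm_sumn pt) sum_t0.
  rewrite card_set_sum (perm_sumn pt) sum_t0 (perm_big _ pt) /= prod_t0.
  by congr (_ * _)%N; apply: eq_bigr => y _; rewrite eq_sym; case: eqP.
have perm_t0 : (size (permutations t0) * \prod_(v <- undup r) (count_mem v r)`!
    * (#|F|.-1 - size r)`! = #|F|.-1`!)%N.
  have r0 : 0%N \notin r by apply/negP => /(allP r_gt0).
  (* The letters of [t0] are those of [r] and possibly 0, which occurs q - 1 - [size r] times. *)
  rewrite -[in RHS]sz_t0 -(size_permutations_mult (u := 0%N :: undup r)); last 2 first.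
  - by rewrite /= mem_undup r0 undup_uniq.
  - move=> x; rewrite mem_cat mem_nseq inE mem_undup.
    by case/orP=> [->|/andP[_ ->]]; rewrite ?orbT.
  rewrite big_cons -mulnA; congr (_ * _)%N; rewrite mulnC; congr (_ * _)%N.
    by rewrite count_cat (count_memPn r0) count_nseq /= mul1n.
  apply: eq_big_seq => v; rewrite mem_undup => vr.
  rewrite count_cat count_nseq /=.
  have -> : (0%N == v) = false by apply: contraNF r0 => /eqP->.
  by rewrite mul0n addn0.
pose c2 := (\prod_(v <- undup r) (count_mem v r)`! * (#|F|.-1 - size r)`!)%N.
have c_gt0 : (0 < c1 * (h - sumn r)`! * c2)%N.
  by rewrite !muln_gt0 !fact_gt0 !prodn_gt0 // => i; apply: fact_gt0.
(* Multiplying by all the factorials avoids division in combining the two counts. *)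
apply/eqP; rewrite -(eqn_pmul2r c_gt0) mulnA. rewrite card_t0; apply/eqP.
have -> : (size (permutations t0) * h`! * c2 = h`! * #|F|.-1`!)%N.
  by rewrite -perm_t0 /c2; ring.
rewrite /Ncount -(bin_fact le_rh) -(bin_fact le_rF) -multinom_mul.
by rewrite -(multinom_ptype_mul r) /c2 -/c1; ring.
Qed.
End Rows.

(** * Zeros of linear forms *)

Section Geometry.
Variable F : finFieldType.

Lemma linformD k (a x y : 'rV[F]_k) : linform a (x + y) = linform a x + linform a y.
Proof. by rewrite /linform -big_split; apply: eq_bigr => i _; rewrite mxE mulrDr. Qed.

Lemma linformZ k (a x : 'rV[F]_k) t : linform a (t *: x) = t * linform a x.
Proof. by rewrite /linform mulr_sumr; apply: eq_bigr => i _; rewrite mxE mulrCA. Qed.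

Lemma linform_delta k (a : 'rV[F]_k) i : linform a (delta_mx ord0 i) = a ord0 i.
Proof.
rewrite /linform (bigD1 i) //= mxE !eqxx mulr1 big1 ?addr0 // => j /negPf nji.
by rewrite mxE nji andbF mulr0.
Qed.

Lemma linform0 k (a : 'rV[F]_k) : linform a 0 = 0.
Proof. by rewrite -(scale0r 0) linformZ mul0r. Qed.

Lemma linform0l k (x : 'rV[F]_k) : linform 0 x = 0.
Proof. by rewrite /linform big1 // => i _; rewrite mxE mul0r. Qed.

(** Translation by [t *: e] carries the zeros of the form in [E] onto its fibre over [t], so all
    fibres have equal size. *)
Lemma card_linform_ker k (E : {set 'rV[F]_k}) (a e : 'rV[F]_k) :
  linform a e = 1 -> (forall t x, x \in E -> x + t *: e \in E) ->
  (#|F| * #|[set x in E | linform a x == 0%R]| = #|E|)%N.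
Proof.
move=> ae1 Ee; rewrite -[in RHS]sum1_card (partition_big (linform a) xpredT) //=.
rewrite -sum_nat_const; apply: eq_bigr => t _.
rewrite sum1dep_card -(card_imset _ (addIr (t *: e))).
apply: eq_card => x; rewrite [in RHS]inE; apply/imsetP/andP => [[y] | [xE /eqP axt]].
  rewrite inE => /andP[yE /eqP ay0] ->.
  by rewrite Ee // linformD linformZ ae1 ay0 mulr1 add0r.
exists (x - t *: e); last by rewrite subrK.
by rewrite inE -scaleNr Ee //= linformD linformZ ae1 axt mulr1 subrr.
Qed.

Lemma perm_flatten_count (C s : seq F) : uniq C -> {subset s <= C} ->
  perm_eq s (flatten [seq nseq (count_mem c s) c | c <- C]).
Proof.
move=> uC sC; apply/allP => c _ /=; apply/eqP.
rewrite count_flatten -map_comp sumnE big_map.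
have [cC|cC] := boolP (c \in C).
  rewrite (bigD1_seq c) //= count_nseq /= eqxx mul1n big1 ?addn0 // => d /negPf ndc.
  by rewrite count_nseq /= ndc.
rewrite (count_memPn (contra (@sC c) cC)) big1_seq // => d /= dC.
by rewrite count_nseq /=; case: eqP => // ed; rewrite -ed dC in cC.
Qed.

(** The nonzero values are listed in the order of [p], and the value 0 forms a final extra block,
    whose size is the last argument of [Aext]. *)
Lemma cnt2_Aext (s : seq F) (p := sort geq [seq m <- mults s | m != 0%N]) :
  p != [::] -> (cnt2 s 0 0)%:Z = Aext F p (size s - sumn p).
Proof.
have sum_p : sumn p = sumn (mults s).
  rewrite (perm_sumn (permEl (perm_sort _ _))).
  by elim: (mults s) => //= -[|m] t /= ->.
rewrite sum_p -(count_mem0 s) addnK.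
have -> : p = [seq count_mem c s | c <- sort (relpre (fun c => count_mem c s) geq)
   [seq c <- enum [set c : F | c != 0] | count_mem c s != 0%N]].
  by rewrite /p /mults filter_map sort_map.
set E := sort _ _ => E0.
have uE : uniq E by rewrite sort_uniq filter_uniq ?enum_uniq.
have memE c : (c \in E) = (c != 0) && (c \in s).
  by rewrite mem_sort mem_filter mem_enum inE andbC -lt0n -has_count has_pred1.
have E'0 : rev E != [::] by rewrite -size_eq0 size_rev size_eq0; case: (E) E0.
rewrite /Aext /A; case: eqP => [/eqP z0|z0].
  (* If 0 does not occur, the convention for a final part 0 applies and no block is added. *)
  rewrite -map_rev -cnt2_flatten ?rev_uniq //; congr (Posz _); apply: cnt2_perm.
  apply: perm_flatten_count; rewrite ?rev_uniq // => c cs.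
  rewrite mem_rev memE cs andbT; apply: contraL z0 => /eqP c0.
  by rewrite -c0 -lt0n -has_count has_pred1.
(* [A] reverses its list, so the final block of zeros comes first. *)
rewrite rev_rcons -map_rev -(cnt2_flatten (fun c => count_mem c s) (C := 0 :: rev E)) //; last first.
  by rewrite /= mem_rev memE eqxx rev_uniq uE.
congr (Posz _); apply: cnt2_perm; apply: perm_flatten_count.
  by rewrite /= mem_rev memE eqxx rev_uniq uE.
by move=> c cs; rewrite inE mem_rev memE cs andbT orbN.
Qed.

(** The zeros of [c] on the projection of U to the first [h] coordinates; [c = 0] gives the
    projection itself. *)
Definition offU h (c : 'rV[F]_h) : {set 'rV[F]_h} :=
  [set y : 'rV[F]_h | [&& [forall i, y ord0 i != 0], \sum_i y ord0 i != 0
                        & linform c y == 0]].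

(** The two terms separate the zeros of [c] with nonzero entries by whether the sum of the entries
    is nonzero or 0; [sum_cnt2] counts them together. *)
Lemma card_offU h (c : 'rV[F]_h) :
  (#|offU c| + cnt2 (rowseq c) 0%R 0%R
   = #|F|.-1 ^ count_mem 0%R (rowseq c) * psi F (h - count_mem 0%R (rowseq c)))%N.
Proof.
have := sum_cnt2 (rowseq c) 0; rewrite size_rowseq psiE => <-.
rewrite (bigD1 0) //= addnC; congr (_ + _)%N.
rewrite -sum1_card (partition_big (fun y : 'rV[F]_h => \sum_i y ord0 i) (predC1 0)) /=.
  apply: eq_bigr => a a0; rewrite -card_cnt2 sum1dep_card.
  apply: eq_card => y; rewrite !inE /= -!andbA; congr (_ && _).
  by have [->|_] := eqVneq (\sum_i y ord0 i) a; rewrite ?a0 ?andbT ?andbF.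
by move=> y; rewrite inE => /and3P[].
Qed.

Lemma card_offU0 h : (#|offU (0 : 'rV[F]_h)| + psi F h = #|F|.-1 ^ h)%N.
Proof.
have e0 : rowseq (0 : 'rV[F]_h) = nseq h 0.
  rewrite /rowseq -[in RHS](size_enum_ord h).
  by elim: (enum 'I_h) => //= i e ->; rewrite mxE.
have := card_offU (0 : 'rV[F]_h).
rewrite e0 count_nseq /= eqxx mul1n subnn psi0 muln1 => <-; congr (_ + _)%N.
rewrite -e0 -card_cnt2; apply: eq_card => x.
by rewrite !inE linform0l eqxx andbT andbC.
Qed.

Lemma card_lsubmx h m (P : pred 'rV[F]_h) :
  #|[set x : 'rV[F]_(h + m) | P (lsubmx x)]| = (#|[set y | P y]| * #|F| ^ m)%N.
Proof.
rewrite [LHS]card_set_sum big_row_mx card_set_sum big_distrl /=; apply: eq_bigr => y _.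
under eq_bigr do rewrite row_mxKl.
by rewrite sum_nat_const card_mx mul1n mulnC.
Qed.

Lemma exists_coord_neq0 k (a : 'rV[F]_k) : a != 0 -> exists i, a ord0 i != 0.
Proof.
move=> a0; apply/existsP; apply: contraNT a0 => /existsPn a0; apply/eqP/rowP => i.
by rewrite mxE; apply/eqP; rewrite -[_ == _]negbK.
Qed.

(** * Weights in the code of D_1 *)

Section Code.
Variables h m : nat.
Hypothesis h2 : (1 < h)%N.
Implicit Types a x : 'rV[F]_(h + m).
Local Notation q := #|F|.
Local Notation D := (D1 F (h + m) h).

Definition offD : {set 'rV[F]_(h + m)} :=
  [set x | lsubmx x \in offU (0 : 'rV[F]_h)].

Lemma big_head (R : Type) (idx : R) (op : Monoid.com_law idx) (f : 'I_(h + m) -> R) :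
  \big[op/idx]_(i < h + m | (i < h)%N) f i = \big[op/idx]_(i < h) f (lshift m i).
Proof.
rewrite big_split_ord /= [X in op _ X]big_pred0 ?Monoid.mulm1.
  by apply: eq_bigl => i; rewrite ltn_ord.
by move=> i /=; rewrite ltnNge leq_addr.
Qed.

Lemma mem_D1 x : (x \in D) = (x != 0) && (x \notin offD).
Proof.
rewrite !inE linform0l eqxx andbT !big_head mulf_eq0 negb_and negbK; congr (_ && _).
have -> : \sum_i lsubmx x ord0 i = \sum_(i < h) x ord0 (lshift m i).
  by apply: eq_bigr => i _; rewrite mxE.
rewrite orbC; congr (_ || _); rewrite negb_forall.
apply/prodf_eq0/existsP => [[i _ xi]|[i]]; first by exists i; rewrite mxE negbK.
by rewrite negbK mxE; exists i.
Qed.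

Lemma offD0 : 0 \notin offD.
Proof.
rewrite !inE; apply/negP => /andP[/forallP/(_ (Ordinal (ltnW h2)))].
by rewrite !mxE eqxx.
Qed.

Lemma card_D1_split (K : {set 'rV[F]_(h + m)}) : 0 \in K ->
  (#|D :&: K| + 1 + #|offD :&: K| = #|K|)%N.
Proof.
move=> K0; rewrite -[RHS](cardsID offD) [K :&: offD]setIC addnC; congr (_ + _)%N.
rewrite (cardsD1 0 (K :\: offD)) inE K0 offD0 addnC; congr (_ + _)%N.
by apply: eq_card => x; rewrite !in_setD1 in_setI in_setD mem_D1 andbA.
Qed.

Lemma card_D1 : (#|D| + 1 + #|offD| = q ^ (h + m))%N.
Proof.
have := card_D1_split (in_setT 0).
by rewrite !setIT cardsT card_mx mul1n.
Qed.

Lemma card_offD : #|offD| = (#|offU (0 : 'rV[F]_h)| * q ^ m)%N.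
Proof.
rewrite /offD (card_lsubmx m (fun y => y \in offU (0 : 'rV[F]_h))); congr (_ * _)%N.
by apply: eq_card => y; rewrite inE.
Qed.

(** As [h] is at least 2, a unit vector has a zero among its first [h] coordinates. So [D] contains
    a basis, and a form is determined by its codeword. *)
Lemma delta_D1 i : delta_mx ord0 i \in D.
Proof.
rewrite mem_D1; apply/andP; split.
  apply/eqP => /rowP/(_ i); rewrite !mxE !eqxx; exact/eqP/oner_neq0.
have [j nji] : exists j : 'I_h, lshift m j != i.
  have [e0|] := eqVneq (lshift m (Ordinal (ltnW h2))) i; last by exists (Ordinal (ltnW h2)).
  by exists (Ordinal h2); rewrite -e0.
rewrite !inE negb_and; apply/orP; left; apply/forallPn; exists j.
by rewrite !mxE (negPf nji) andbF eqxx.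
Qed.

Lemma codeword_inj : injective (@codeword F (h + m) D).
Proof.
move=> a b /ffunP eq_ab; apply/rowP => i; have := eq_ab (delta_mx ord0 i).
by rewrite !ffunE delta_D1 !linform_delta.
Qed.

Lemma codeword_eq0 a : (codeword D a == 0) = (a == 0).
Proof.
rewrite -(inj_eq codeword_inj); congr (_ == _); apply/ffunP => x.
by rewrite !ffunE linform0l; case: ifP.
Qed.

(** The hyperplane of zeros of the form consists of its points in [D], the origin and its points in
    U. *)
Lemma wt_codeword a : a != 0 ->
  (wt (codeword D a) + q ^ (h + m).-1
   = #|D| + 1 + #|[set x in offD | linform a x == 0%R]|)%N.
Proof.
move=> a0; pose K := [set x | linform a x == 0].
have [i ai] := exists_coord_neq0 a0.
have cardK : #|K| = (q ^ (h + m).-1)%N.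
  have q_gt0 : (0 < q)%N by apply: ltnW; apply: finNzRing_gt1.
  apply/eqP; rewrite -(eqn_pmul2l q_gt0) -expnS prednK ?addn_gt0 ?(ltnW h2) //.
  have <- : #|[set: 'rV[F]_(h + m)]| = (q ^ (h + m))%N by rewrite cardsT card_mx mul1n.
  apply/eqP.
  rewrite -(@card_linform_ker _ setT a ((a ord0 i)^-1 *: delta_mx ord0 i)).
  - by congr (_ * _)%N; apply: eq_card => x; rewrite !inE.
  - by rewrite linformZ linform_delta mulVf.
  by move=> t x _; rewrite inE.
have K0 : 0 \in K by rewrite inE linform0.
rewrite -cardK -(card_D1_split K0) -(cardsID K D).
have -> : wt (codeword D a) = #|D :\: K|.
  apply: eq_card => x; rewrite in_setD inE [x \in K]inE ffunE andbC.
  by case: ifP; rewrite ?eqxx.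
have -> : [set x in offD | linform a x == 0] = offD :&: K.
  by apply/setP => x; rewrite !inE.
by ring.
Qed.

Lemma tail0E a : tail0 h a = (rsubmx a == 0).
Proof.
apply/forallP/eqP => [t0|/rowP t0 i].
  apply/rowP => i; have := t0 (rshift h i).
  by rewrite leq_addr /= !mxE => /eqP.
case: (split_ordP i) => [j|j] -> /=; first by rewrite leqNgt ltn_ord.
by rewrite leq_addr; have := t0 j; rewrite !mxE => ->; rewrite eqxx.
Qed.

Lemma patternE a :
  pattern h a = sort geq [seq k <- mults (rowseq (lsubmx a)) | k != 0%N].
Proof.
rewrite /pattern /mults; congr (sort _ (filter _ _)); apply: eq_map => c.
rewrite -sum1dep_card big_mkcondr /= (big_head addn) count_map -sum1_count.
rewrite [RHS]big_mkcond big_enum /=.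
by apply: eq_bigr => i _; rewrite mxE.
Qed.

Lemma card_offD_lin_tail a : ~~ tail0 h a ->
  (q * #|[set x in offD | linform a x == 0%R]| = #|offD|)%N.
Proof.
rewrite tail0E => /exists_coord_neq0[i]; rewrite mxE => ai.
apply: (@card_linform_ker _ _ _ ((a ord0 (rshift h i))^-1 *: delta_mx ord0 (rshift h i))).
  by rewrite linformZ linform_delta mulVf.
move=> t x; rewrite ![_ \in offD]inE scalerA !linearD !linearZ /=.
suff -> : lsubmx (delta_mx ord0 (rshift h i)) = 0 :> 'rV[F]_h by rewrite scaler0 addr0.
by apply/rowP => j; rewrite !mxE eq_lrshift.
Qed.

Lemma card_offD_lin_tail0 a : tail0 h a ->
  #|[set x in offD | linform a x == 0%R]| = (#|offU (lsubmx a)| * q ^ m)%N.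
Proof.
rewrite tail0E => /eqP ra0; rewrite -card_lsubmx; apply: eq_card => x.
rewrite !inE linform0l eqxx andbT -andbA; congr [&& _, _ & _ == 0].
rewrite /linform big_split_ord /= [X in _ + X]big1 ?addr0.
  by apply: eq_bigr => i _; rewrite !mxE.
by move=> i _; have /rowP/(_ i) := ra0; rewrite !mxE => ->; rewrite mul0r.
Qed.

Lemma card_tail0 (P : pred 'rV[F]_h) :
  #|[set a : 'rV[F]_(h + m) | tail0 h a && P (lsubmx a)]| = #|[set y | P y]|.
Proof.
have injL : injective (fun y : 'rV[F]_h => row_mx y (0 : 'rV[F]_m)).
  by move=> y z /eq_row_mx[].
rewrite -[RHS](card_imset _ injL); apply: eq_card => a; rewrite inE tail0E.
apply/andP/imsetP => [[/eqP ra Pa]|[y]]; last first.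
  by rewrite inE => Py ->; rewrite row_mxKr row_mxKl.
by exists (lsubmx a); rewrite ?inE // -ra hsubmxK.
Qed.

Lemma sumn_pattern a :
  (count_mem 0%R (rowseq (lsubmx a)) + sumn (pattern h a) = h)%N.
Proof.
rewrite -[RHS](size_rowseq (lsubmx a)) -count_mem0 patternE; congr (_ + _)%N.
rewrite (perm_sumn (permEl (perm_sort _ _))).
by elim: (mults _) => //= -[|p] t /= ->.
Qed.

Lemma pattern_partition a : tail0 h a -> a != 0 -> is_partition h (pattern h a).
Proof.
move=> ta a0; have sum_p := sumn_pattern a.
apply/and3P; split; last apply/andP; last split.
- by rewrite patternE sort_sorted // => x y; rewrite /geq /=; lia.
- by rewrite patternE all_sort; apply/allP => x; rewrite mem_filter lt0n => /andP[].
(* A pattern of sum 0 would make the first [h] coefficients vanish, and the tail vanishes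
   already. *)
- rewrite lt0n; apply: contraNneq a0 => s0; move: sum_p; rewrite s0 addn0 => all0.
  move: ta; rewrite tail0E -[a]hsubmxK row_mxKr => /eqP->.
  suff -> : lsubmx a = 0 by rewrite row_mx0.
  have : all (pred1 0) (rowseq (lsubmx a)) by rewrite all_count all0 size_rowseq.
  move/allP => all_0; apply/rowP => i; rewrite [RHS]mxE; apply/eqP/all_0.
  by rewrite map_f ?mem_enum.
- by rewrite -[X in (_ <= X)%N]sum_p leq_addl.
Qed.

End Code.
End Geometry.

(** * The weight distribution *)

Theorem theorem2p5 (F : finFieldType) (k h : nat) (h4 : (4 <= h)%N) (hk : (h <= k)%N) :
  let q := #|F| in
  let D := D1 F k h in
  let n := #|D| in
  let X : rat := n%:R - q%:R ^ (k%:Z - h%:Z - 1)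
                   * (q%:R ^+ h + (psi F h)%:R - (q%:R - 1) ^+ h) + 1 in
  let Y (r : seq nat) : rat :=
    n%:R - q%:R ^+ (k - 1) + (q%:R - 1) ^+ (h - sumn r) * q%:R ^+ (k - h) * (psi F (sumn r))%:R
    - q%:R ^+ (k - h) * (Aext F r (h - sumn r))%:~R + 1 in
  let SX := codeword D @: [set alpha : 'rV[F]_k | ~~ tail0 h alpha] in
  let S (r : seq nat) := codeword D @: [set alpha : 'rV[F]_k | tail0 h alpha && (pattern h alpha == r)] in
  [/\ n%:R = q%:R ^ (k%:Z - h%:Z - 1) * (q%:R ^+ h.+1 - (q%:R - 1) ^+ h.+1
                                       + (-1) ^+ h * (q%:R - 1)) - 1 :> rat,
      (* the codewords from forms with nonzero tail: q^k - q^h of them, weight X *)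
      #|SX| = (q ^ k - q ^ h)%N /\ (forall c, c \in SX -> c != 0 /\ (wt c)%:R = X),
      (* for each partition r of s in [1,h]: Ncount of them, weight Y r *)
      (forall r, is_partition h r ->
         #|S r| = Ncount q h r /\ (forall c, c \in S r -> c != 0 /\ (wt c)%:R = Y r)),
      (* these classes are pairwise disjoint ... *)
      (forall r, is_partition h r -> [disjoint SX & S r]) /\
      (forall r r', is_partition h r -> is_partition h r' -> r != r' -> [disjoint S r & S r'])
    & (* ... and exhaust the nonzero codewords of C_{D_1} *)
      (forall c, c \in code D -> c != 0 ->
         c \in SX \/ exists2 r, is_partition h r & c \in S r)].
Proof.
have h2 : (1 < h)%N by apply: leq_trans h4.
rewrite -(subnKC hk); move: (k - h)%N => m {k hk} q D n X Y SX S.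
have q_gt0 : (0 < q)%N by apply: ltnW; apply: finNzRing_gt1.
have inj := @codeword_inj F h m h2.
have qR0 : q%:R != 0 :> rat by rewrite pnatr_eq0 -lt0n.
have predq : (#|F|.-1)%:R = q%:R - 1 :> rat by rewrite -subn1 natrB.
(* The exponent is -1 when [m] is 0, hence the quotient instead of a natural power. *)
have e_exp : q%:R ^ ((h + m)%N%:Z - h%:Z - 1) = q%:R ^+ m / q%:R :> rat.
  have -> : (h + m)%N%:Z - h%:Z - 1 = m%:Z + (-1) by lia.
  by rewrite expfzDr.
have cU0 : #|offU (0 : 'rV[F]_h)|%:R = (q%:R - 1) ^+ h - (psi F h)%:R :> rat.
  by rewrite -predq -natrX -card_offU0 natrD addrK.
have cU : #|offD F h m|%:R = ((q%:R - 1) ^+ h - (psi F h)%:R) * q%:R ^+ m :> rat.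
  by rewrite card_offD natrM cU0 natrX.
have cD : n%:R = q%:R ^+ (h + m) - 1 - #|offD F h m|%:R :> rat.
  by rewrite -natrX -(card_D1 F m h2) !natrD; ring.
have wtE a : a != 0 -> (wt (codeword D a))%:R
   = n%:R + 1 + #|[set x in offD F h m | linform a x == 0]|%:R - q%:R ^+ (h + m).-1 :> rat.
  move=> a0; have /(congr1 (fun x => x%:R : rat)) := wt_codeword h2 a0.
  by rewrite !natrD natrX => <-; rewrite addrK.
(* Obtained by eliminating phi between psi + (q-1) phi = (q-1)^h and psi - phi = (-1)^h. *)
have psi_q : q%:R * (psi F h)%:R = (q%:R - 1) ^+ h + (-1) ^+ h * (q%:R - 1) :> rat.
  have /(congr1 (fun x : int => x%:~R : rat)) := psi_phi F h.
  rewrite rmorphB rmorphXn rmorphN1 /= => <-.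
  rewrite -predq -natrX -psi_addS psiS natrD natrM predq.
  by rewrite !pmulrn; ring.
have tail_neq0 (a : 'rV[F]_(h + m)) : ~~ tail0 h a -> a != 0.
  by apply: contraNneq => ->; rewrite tail0E linear0.
have pat_neq0 (a : 'rV[F]_(h + m)) r : is_partition h r -> pattern h a = r -> a != 0.
  move=> /and3P[_ _ /andP[r_gt0 _]] def_r; apply: contraTneq r_gt0 => a0.
  have := sumn_pattern a; rewrite def_r a0 linear0.
  have -> : count_mem 0 (rowseq (0 : 'rV[F]_h)) = h.
    apply/eqP; rewrite -[X in _ == X](size_rowseq (0 : 'rV[F]_h)) -all_count.
    by apply/allP => _ /mapP[i _ ->]; rewrite mxE /=.
  by lia.
split.
- rewrite cD cU e_exp [in RHS]exprS [in RHS]exprS exprD.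
  move: psi_q; set Q := q%:R; set p := _%:R; set e := (-1) ^+ h => psi_q.
  have -> : p = ((Q - 1) ^+ h + e * (Q - 1)) / Q by rewrite -psi_q mulrC mulKf.
  by field.
- split; last first.
    move=> c /imsetP[a]; rewrite inE => ta ->{c}; have a0 := tail_neq0 a ta.
    rewrite codeword_eq0 // wtE //; split=> //.
    have /(congr1 (fun x => x%:R : rat)) := card_offD_lin_tail ta.
    rewrite natrM cU -/q /X e_exp; set z := #|[set x in offD F h m | _]|%:R => ez.
    have -> : z = ((q%:R - 1) ^+ h - (psi F h)%:R) * q%:R ^+ m / q%:R.
      by rewrite -ez mulrC mulKf.
    have -> : q%:R ^+ (h + m).-1 = q%:R ^+ h * q%:R ^+ m / q%:R :> rat.
      by rewrite -exprD -[in RHS](prednK (n := (h + m)%N)) ?exprSr ?mulfK // addn_gt0 ltnW.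
    by field.
  have card_t0 : #|[set a : 'rV[F]_(h + m) | tail0 h a]| = (q ^ h)%N.
    have := card_tail0 m (fun _ : 'rV[F]_h => true).
    rewrite [RHS]cardsT card_mx mul1n => <-.
    by apply: eq_card => a; rewrite !inE andbT.
  rewrite card_imset // -card_t0 -[X in (_ ^ X)%N]mul1n -card_mx.
  rewrite -(cardsC [set a : 'rV[F]_(h + m) | tail0 h a]) addKn.
  by apply: eq_card => a; rewrite !inE.
- move=> r r_part; split.
    rewrite card_imset // -(card_rows_pattern F r_part) -[RHS](card_tail0 m).
    by apply: eq_card => a; rewrite !inE patternE.
  move=> c /imsetP[a]; rewrite inE => /andP[ta /eqP def_r] ->{c}.
  have a0 := pat_neq0 a r r_part def_r.
  rewrite codeword_eq0 // wtE //; split=> //.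
  have r_neq0 : pattern h a != [::].
    by apply: contraTneq r_part => rn; rewrite -def_r rn /is_partition /=.
  have sum_r := sumn_pattern a.
  have := cnt2_Aext (s := rowseq (lsubmx a)).
  rewrite -patternE size_rowseq => /(_ r_neq0).
  have le_rh : (sumn r <= h)%N by case/and3P: r_part => _ _ /andP[].
  (* The number of vanishing coefficients is both the exponent of q - 1 in [card_offU] and the extra
     part in [Aext]. *)
  have z_r : (count_mem 0%R (rowseq (lsubmx a)) = h - sumn r)%N.
    by apply/eqP; rewrite -(eqn_add2r (sumn r)) -{1}def_r sum_r subnK.
  have := card_offU (lsubmx a); rewrite z_r (subKn le_rh) def_r.
  move/(congr1 (fun x => x%:R : rat)); rewrite natrD natrM natrX predq => eU eA.
  have eA' : (cnt2 (rowseq (lsubmx a)) 0 0)%:R = (Aext F r (h - sumn r))%:~R :> rat.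
    by rewrite -eA pmulrn.
  rewrite card_offD_lin_tail0 // natrM natrX /Y addKn subn1 -eA'.
  move: eU => /(canRL (addrK _)) ->.
  by ring.
- split=> [r r_part | r r' r_part r'_part nrr'].
    apply/pred0P => c /=; apply/andP => -[/imsetP[a]]; rewrite inE => ta ->.
    by case/imsetP => b; rewrite inE => /andP[tb _] /inj eab; rewrite eab tb in ta.
  apply/pred0P => c /=; apply/andP => -[/imsetP[a]]; rewrite inE => /andP[_ /eqP pa] ->.
  case/imsetP => b; rewrite inE => /andP[_ /eqP pb] /inj eab.
  by rewrite -pa -pb eab eqxx in nrr'.
move=> _ /imsetP[a _ ->]; rewrite codeword_eq0 // => a0.
have [ta|ta] := boolP (tail0 h a); last by left; apply/imsetP; exists a; rewrite ?inE.
right; exists (pattern h a); first exact: pattern_partition.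
by apply/imsetP; exists a; rewrite ?inE ?ta ?eqxx.
Qed.
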